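(* For each of the two passenger responses (Linear and MinImprov), the bi-objective BRT investment problem without BRT component constraint, $\textsc{BRT}(\star/Z=\infty/|M|\ge1)$, is intractable, even if $|M|=1$ and $Z=\infty$.
   Context: An instance consists of: a linear graph $G=(V,E)$ with $V=\{1,\dots,n\}$, $n\in\mathbb N_{\ge1}$ and $E=\{e_i=\{i,i+1\}: i\in\{1,\dots,n-1\}\}$ (segments); upgrade costs $c_e\in\mathbb N_{\ge1}$ for $e\in E$; a finite set $M$ of municipalities with pairwise disjoint sets $E_m\subseteq E$ of consecutive segments, $\bigcup_{m\in M}E_m=E$; budget shares $b_m\in\mathbb R_{>0}$ with $\sum_{m\in M}b_m=1$; a set of OD pairs $D\subseteq\{(i,j):i,j\in V,i\neq j\}$, where $W_d\subseteq E$ denotes the edge set of the unique path from $i$ to $j$ in $G$ for $d=(i,j)\in D$; numbers of potential passengers $a_d\in\mathbb N_{\ge1}$ for $d\in D$; infrastructure improvements $u_e\in\mathbb R_{>0}$ for $e\in E$; and, for MinImprov, thresholds $L_d\in\mathbb R_{\ge0}$ with $L_d\le\sum_{e\in W_d}u_e$ for $d\in D$. For $F\subseteq E$ the number of newly attracted passengers is $p(F)=\sum_{d\in D}p_d(F)$, where in Linear $p_d(F)=a_d\cdot\frac{\sum_{e\in F\cap W_d}u_e}{\sum_{e\in W_d}u_e}$, and in MinImprov $p_d(F)=a_d$ if $L_d\le\sum_{e\in F\cap W_d}u_e$ and $p_d(F)=0$ otherwise. A pair $(F,v)$ with $F\subseteq E$, $v\in\mathbb R_{\ge0}$ is feasible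 if $\sum_{e\in F\cap E_m}c_e\le b_m v$ for all $m\in M$. (''$Z=\infty$'' means that there is no constraint on the number of connected components of the subgraph induced by $F$.) The problem is to maximize $p(F)$ and minimize $v$ over feasible $(F,v)$. The point $(p(F),v)$ of a feasible $(F,v)$ is non-dominated if there is no feasible $(F',v')$ with $p(F')\ge p(F)$, $v'\le v$ and at least one inequality strict. The Pareto front is the set of all non-dominated points. Intractable means that the Pareto front may contain an exponential number of non-dominated points: there is a family of instances, of encoding size polynomial in $n$, whose number of non-dominated points is exponential in $n$. *)

(* Defs.v *)
From HB Require Import structures.
From mathcomp Require Import all_boot all_order all_algebra.
From mathcomp Require Import all_classical all_reals.
From mathcomp Require Import finmap zify.

Set Implicit Arguments.
Unset Strict Implicit.
Unset Printing Implicit Defensive.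

Import Order.TTheory GRing.Theory Num.Theory.

Local Open Scope ring_scope.

(* Vertices are counted from 0; the k-th segment joins k and k + 1. *)
Definition seg_ends n (k : 'I_n.-1) : {set 'I_n} :=
  [set x : 'I_n | (x == k :> nat) || (x == k.+1 :> nat)].

Definition adj n : rel 'I_n :=
  fun x y => [exists k : 'I_n.-1, seg_ends k == [set x; y]%SET].

Definition simple_path n (x y : 'I_n) (p : seq 'I_n) : bool :=
  [&& path (@adj n) x p, last x p == y & uniq (x :: p)].

Definition traversed n (x : 'I_n) (p : seq 'I_n) (k : 'I_n.-1) : bool :=
  seg_ends k \in pairmap (fun y z => [set y; z]%SET) x p.

Definition path_segs n (d : 'I_n * 'I_n) : {set 'I_n.-1} :=
  [set k : 'I_n.-1 |
    `[< exists2 p, simple_path d.1 d.2 p & traversed d.1 p k >]].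

Lemma seg_endsP n (k : 'I_n.-1) (x y : 'I_n) :
  reflect ((x = k :> nat /\ y = k.+1 :> nat) \/
           (y = k :> nat /\ x = k.+1 :> nat))
          (seg_ends k == [set x; y]%SET).
Proof.
have n_gt : (k.+1 < n)%N by case: k => k /=; lia.
have n_gt' : (k < n)%N by lia.
apply: (iffP eqP) => [/setP e|].
  have := e x; have := e y.
  have := e (Ordinal n_gt'); have := e (Ordinal n_gt).
  by rewrite !inE -!val_eqE /=; lia.
by case=> -[ex ey]; apply/setP => z; rewrite !inE -!val_eqE /= ex ey // orbC.
Qed.

Lemma adjP n (x y : 'I_n) :
  reflect (y = x.+1 :> nat \/ x = y.+1 :> nat) (adj x y).
Proof.
apply: (iffP existsP) => [[k /seg_endsP]|]; first by lia.
move=> e; have k_lt : (minn x y < n.-1)%N.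
  by have := ltn_ord x; have := ltn_ord y; lia.
by exists (Ordinal k_lt); apply/seg_endsP => /=; lia.
Qed.

Lemma path_cross n (k : 'I_n.-1) (x : 'I_n) p : path (@adj n) x p ->
  (x <= k < last x p)%N || (last x p <= k < x)%N ->
  [/\ traversed x p k, exists2 z, z \in x :: p & z = k :> nat
    & exists2 z, z \in x :: p & z = k.+1 :> nat].
Proof.
elim: p x => [|z p IH] x /=; first by lia.
move=> /andP[/adjP xz zp] cr.
have [/eqP e|ne] := boolP (seg_ends k == [set x; z]%SET).
  have /seg_endsP/= h := introT eqP e.
  split; first by rewrite /traversed /= inE e eqxx.
    by case: h => -[h1 h2]; [exists x | exists z]; rewrite // !inE eqxx ?orbT.
  by case: h => -[h1 h2]; [exists z | exists x]; rewrite // !inE eqxx ?orbT.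
have ne' : ~ ((x = k :> nat /\ z = k.+1 :> nat) \/
              (z = k :> nat /\ x = k.+1 :> nat)) by move/seg_endsP; apply/negP.
have [|tr [v vp ev] [w wp ew]] := IH z zp; first by lia.
split; first by rewrite /traversed /= inE -/(traversed z p k) tr orbT.
  by exists v => //; rewrite inE vp orbT.
by exists w => //; rewrite inE wp orbT.
Qed.

Lemma simple_path_exists n (x y : 'I_n) : exists p, simple_path x y p.
Proof.
have cxy : connect (@adj n) x y.
  have [m] := ubnP (maxn x y - minn x y).
  elim: m x => // m IH x lt_m.
  have [->|ne] := eqVneq x y; first exact: connect0.
  have ne' : (x != y :> nat) by [].
  have [w wn [xw lt_w]] : exists2 w, (w < n)%N &
      (w = x.+1 \/ nat_of_ord x = w.+1) /\
      (maxn w y - minn w y < maxn x y - minn x y)%N.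
    have [xy|yx] := ltnP x y.
      by exists x.+1; have := ltn_ord y; lia.
    by exists x.-1; have := ltn_ord x; lia.
  apply: (@connect_trans _ _ (Ordinal wn)); first exact/connect1/adjP.
  by apply: IH => /=; lia.
have [p xp ->] := connectP cxy.
have [p' xp' up' _] := shortenP xp.
by exists p'; rewrite /simple_path xp' eqxx.
Qed.

Lemma simple_path_traversed n (x y : 'I_n) p (k : 'I_n.-1) :
  simple_path x y p -> traversed x p k = (minn x y <= k < maxn x y)%N.
Proof.
case/and3P => xp /eqP <- up; apply/idP/idP; last first.
  by move=> h; have [|->] := path_cross xp (k := k) => //; lia.
elim: p x xp up => [//|z p IH] x /= /andP[/adjP xz zp] /andP[xNp up].
rewrite /traversed /= inE -/(traversed z p k) => /orP[/seg_endsP h|tr].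
  have [//|nb] := boolP (_ <= k < _)%N; exfalso.
  have [|_ [v vp ev] [w wp ew]] := path_cross (k := k) zp; first by lia.
  case: h => -[h1 h2].
    by have e : v = x :> 'I_n; [apply: val_inj => /=; lia | rewrite -e vp in xNp].
  by have e : w = x :> 'I_n; [apply: val_inj => /=; lia | rewrite -e wp in xNp].
have := IH z zp up tr.
have [h _|nb] := boolP (minn x (last z p) <= k < maxn x (last z p))%N; first by [].
move=> h2.
have [h3 | h3] : (x = k :> nat /\ z = k.+1 :> nat) \/
                (z = k :> nat /\ x = k.+1 :> nat) by lia.
  have [|_ [v vp ev] _] := path_cross (k := k) zp; first by lia.
  by have e : v = x :> 'I_n; [apply: val_inj => /=; lia | rewrite -e vp in xNp].
have [|_ _ [w wp ew]] := path_cross (k := k) zp; first by lia.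
by have e : w = x :> 'I_n; [apply: val_inj => /=; lia | rewrite -e wp in xNp].
Qed.

Lemma path_segsE n (d : 'I_n * 'I_n) :
  path_segs d = [set k : 'I_n.-1 | (minn d.1 d.2 <= k < maxn d.1 d.2)%N].
Proof.
apply/setP => k; rewrite !inE; apply/asboolP/idP => [[p dp]|h].
  by rewrite (simple_path_traversed k dp).
have [p dp] := simple_path_exists d.1 d.2.
by exists p; rewrite // (simple_path_traversed k dp).
Qed.

Variant response := Linear | MinImprov.

(* The maps on pairs of vertices are only meaningful on [od_pairs]; the map
   [threshold] is part of the data for MinImprov only. *)
Record instance (R : realType) (rsp : response) := Instance {
  nverts : nat;
  nverts_gt0 : (0 < nverts)%N;
  cost : 'I_nverts.-1 -> nat;
  cost_gt0 : forall e, (0 < cost e)%N;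
  muni : finType;
  muni_segs : muni -> {set 'I_nverts.-1};
  muni_disjoint : forall m m', m != m' ->
    [disjoint muni_segs m & muni_segs m'];
  muni_consecutive : forall m (e f g : 'I_nverts.-1), (e <= f <= g)%N ->
    e \in muni_segs m -> g \in muni_segs m -> f \in muni_segs m;
  muni_cover : (\bigcup_(m : muni) muni_segs m = [set: 'I_nverts.-1])%SET;
  share : muni -> R;
  share_gt0 : forall m, 0 < share m;
  share_sum : \sum_m share m = 1;
  od_pairs : {set 'I_nverts * 'I_nverts};
  od_pairs_neq : forall d, d \in od_pairs -> d.1 != d.2;
  passengers : 'I_nverts * 'I_nverts -> nat;
  passengers_gt0 : forall d, d \in od_pairs -> (0 < passengers d)%N;
  improv : 'I_nverts.-1 -> R;
  improv_gt0 : forall e, 0 < improv e;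
  threshold : 'I_nverts * 'I_nverts -> R;
  threshold_bounds : rsp = MinImprov -> forall d, d \in od_pairs ->
    0 <= threshold d <= \sum_(e in path_segs d) improv e
}.

Arguments cost {R rsp} I e : rename.
Arguments muni_segs {R rsp} I m : rename.
Arguments share {R rsp} I m : rename.
Arguments passengers {R rsp} I d : rename.
Arguments improv {R rsp} I e : rename.
Arguments threshold {R rsp} I d : rename.

Definition attracted_by (R : realType) rsp (I : instance R rsp)
    (F : {set 'I_(nverts I).-1}) (d : 'I_(nverts I) * 'I_(nverts I)) : R :=
  let gained := \sum_(e in F :&: path_segs d) improv I e in
  match rsp with
  | Linear =>
      (passengers I d)%:R * (gained / \sum_(e in path_segs d) improv I e)
  | MinImprov => if threshold I d <= gained then (passengers I d)%:R else 0
  end.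
Arguments attracted_by {R rsp} I F d : rename.

Definition attracted (R : realType) rsp (I : instance R rsp)
    (F : {set 'I_(nverts I).-1}) : R :=
  \sum_(d in od_pairs I) attracted_by I F d.
Arguments attracted {R rsp} I F : rename.

(* Z = infinity: no constraint on the connected components of F. *)
Definition feasible (R : realType) rsp (I : instance R rsp)
    (F : {set 'I_(nverts I).-1}) (v : R) : Prop :=
  0 <= v /\ forall m : muni I,
    (\sum_(e in F :&: muni_segs I m) cost I e)%:R <= share I m * v.
Arguments feasible {R rsp} I F v : rename.

Definition nondominated (R : realType) rsp (I : instance R rsp)
    (F : {set 'I_(nverts I).-1}) (v : R) : Prop :=
  ~ exists F' v', [/\ feasible I F' v', attracted I F <= attracted I F', v' <= v
                    & attracted I F < attracted I F' \/ v' < v].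
Arguments nondominated {R rsp} I F v : rename.

Definition pareto_front (R : realType) rsp (I : instance R rsp) :
    set (R * R) :=
  [set z | exists F v, [/\ feasible I F v, nondominated I F v
                         & z = (attracted I F, v)]]%classic.

Definition nat_bits (k : nat) : nat := (trunc_log 2 k).+1.

(* One sign bit, then the reduced fraction. *)
Definition rat_bits (q : rat) : nat :=
  (1 + nat_bits `|numq q| + nat_bits `|denq q|)%N.

(* Only meaningful when x is rational. *)
Definition real_bits (R : realType) (x : R) : nat :=
  rat_bits (xget 0 [set q | ratr q = x]%classic).

Definition rational_data (R : realType) rsp (I : instance R rsp) : Prop :=
  [/\ forall m, share I m \in @rational R,
      forall e, improv I e \in @rational R
    & rsp = MinImprov ->
      forall d, d \in od_pairs I -> threshold I d \in @rational R].

(* Binary encoding, each municipality listing its segments and each OD pair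
   its two end points. *)
Definition encoding_size (R : realType) rsp (I : instance R rsp) : nat :=
  (nat_bits (nverts I)
   + \sum_(e : 'I_(nverts I).-1) (nat_bits (cost I e) + real_bits (improv I e))
   + \sum_(m : muni I)
       (real_bits (share I m) + \sum_(e in muni_segs I m) nat_bits e)
   + \sum_(d in od_pairs I)
       (nat_bits d.1 + nat_bits d.2 + nat_bits (passengers I d)
        + if rsp is MinImprov then real_bits (threshold I d) else 0))%N.

(* The problem whose instances are restricted to the class [C] is intractable.
   [fset_set] of an infinite set is empty, so the last bound also says that
   the Pareto front is finite. *)
Definition intractable (R : realType) rsp (C : instance R rsp -> Prop) :
    Prop :=
  exists I : nat -> instance R rsp,
    (forall n, (0 < n)%N -> [/\ C (I n), nverts (I n) = n & rational_data (I n)])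
    /\ (exists a k : nat, forall n, (0 < n)%N ->
          (encoding_size (I n) <= a * n ^ k)%N)
    /\ (exists2 b : R, 1 < b & exists N : nat, forall n, (N <= n)%N ->
          b ^+ n <= (#|` fset_set (pareto_front (I n)) |)%:R).

(* Main.v *)
Require Import Defs.
From mathcomp Require Import all_boot all_order all_algebra.
From mathcomp Require Import all_classical all_reals.
From mathcomp Require Import finmap zify.

(** Give the [e]-th segment cost [2 ^ e], improvement [1] and one OD pair made
    of its two end points, with [2 ^ e] passengers, and put all the segments
    into one municipality.  Under both responses an OD pair is attracted fully
    or not at all, so [p F] is the cost of [F].  Investing exactly the cost
    of [F] is then non-dominated, and by binary expansion these costs take
    every value below [2 ^ (n - 1)]. *)

Set Implicit Arguments.
Unset Strict Implicit.
Unset Printing Implicit Defensive.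

Import Order.TTheory GRing.Theory Num.Theory.

Local Open Scope ring_scope.

(** By induction on [m]: passing from [k %% 2 ^ m] to [k %% 2 ^ m.+1] adds the digit of weight
    [2 ^ m]. *)
Lemma sum_binary_digits (m k : nat) :
  (\sum_(i < m) odd (k %/ 2 ^ i) * 2 ^ i = k %% 2 ^ m)%N.
Proof.
elim: m => [|m IH]; first by rewrite big_ord0 modn1.
rewrite big_ord_recr /= IH expnSr.
have m_gt0 : (0 < 2 ^ m)%N by rewrite expn_gt0.
have e : (k = k %/ 2 ^ m %/ 2 * (2 ^ m * 2)
              + (odd (k %/ 2 ^ m) * 2 ^ m + k %% 2 ^ m))%N.
  rewrite {1}(divn_eq k (2 ^ m)) {1}(divn_eq (k %/ 2 ^ m) 2) modn2.
  by rewrite mulnDl -mulnA (mulnC 2) addnA.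
rewrite [in RHS]e modnMDl [RHS]modn_small; first by rewrite addnC.
have := ltn_pmod k m_gt0; case: odd; lia.
Qed.

Lemma sum_pow2_onto (m k : nat) : (k < 2 ^ m)%N ->
  exists F : {set 'I_m}, (\sum_(e in F) 2 ^ e = k)%N.
Proof.
move=> k_lt; exists [set e : 'I_m | odd (k %/ 2 ^ e)]%SET.
rewrite -[RHS](modn_small k_lt) -sum_binary_digits big_mkcond /=.
by apply: eq_bigr => e _; rewrite inE; case: odd; rewrite ?mul1n.
Qed.

(** This crude bound suffices for vertex and segment numbers. Costs and passenger numbers are
    exponential in [m] and need the exact count for powers of two. *)
Lemma nat_bits_le (k : nat) : (nat_bits k <= k.+1)%N.
Proof.
rewrite /nat_bits ltnS; case: k => [|k]; first by rewrite trunc_log0.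
apply: leq_trans (trunc_logP (ltnSn 1) (ltn0Sn k)).
exact: ltnW (ltn_expl _ (ltnSn 1)).
Qed.

Lemma nat_bits_pow2 (e : nat) : nat_bits (2 ^ e) = e.+1.
Proof. by rewrite /nat_bits trunc_expnK. Qed.

Lemma real_bits1 (R : realType) : real_bits (1 : R) = 3%N.
Proof.
rewrite /real_bits; case: xgetP => [q _ /= q1|/(_ 1)/=]; last first.
  by rewrite rmorph1.
have -> : q = 1 by apply: (fmorph_inj (@ratr R)); rewrite [LHS]q1 rmorph1.
by rewrite /rat_bits /nat_bits /= trunc_log1.
Qed.

Section PowerInstance.
Variables (R : realType) (rsp : response) (m : nat).

Definition end_pair (e : 'I_m) : 'I_m.+1 * 'I_m.+1 :=
  (widen_ord (leqnSn m) e, lift ord0 e).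

Lemma end_pair_inj : injective end_pair.
Proof. by move=> e f /(congr1 (fun d => val d.1)) /= ef; apply: val_inj. Qed.

Definition end_pairs : {set 'I_m.+1 * 'I_m.+1} := (end_pair @: [set: 'I_m])%SET.

Lemma path_segs_end_pair (e : 'I_m) :
  path_segs (n := m.+1) (end_pair e) = [set e]%SET.
Proof.
rewrite path_segsE; apply/setP => k; rewrite !inE -val_eqE /= /bump /=; lia.
Qed.

Fact power_cost_gt0 (e : 'I_m.+1.-1) : (0 < 2 ^ e)%N.
Proof. by rewrite expn_gt0. Qed.

Fact power_muni_disjoint (x y : unit) :
  x != y -> [disjoint [set: 'I_m.+1.-1] & [set: 'I_m.+1.-1]].
Proof. by case: x; case: y; rewrite eqxx. Qed.

Fact power_muni_consecutive (x : unit) (e f g : 'I_m.+1.-1) : (e <= f <= g)%N ->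
  e \in [set: 'I_m.+1.-1]%SET -> g \in [set: 'I_m.+1.-1]%SET ->
  f \in [set: 'I_m.+1.-1]%SET.
Proof. by rewrite !inE. Qed.

Fact power_muni_cover :
  (\bigcup_(x : unit) [set: 'I_m.+1.-1] = [set: 'I_m.+1.-1])%SET.
Proof. by apply/setP => e; rewrite inE; apply/bigcupP; exists tt. Qed.

Fact power_share_sum : \sum_(x : unit) (1 : R) = 1.
Proof. by rewrite sumr_const card_unit. Qed.

Fact power_od_neq d : d \in end_pairs -> d.1 != d.2.
Proof. by case/imsetP => e _ ->; rewrite -val_eqE /= /bump /=; lia. Qed.

Fact power_passengers_gt0 (d : 'I_m.+1 * 'I_m.+1) :
  d \in end_pairs -> (0 < 2 ^ d.1)%N.
Proof. by rewrite expn_gt0. Qed.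

Fact power_threshold_bounds : rsp = MinImprov -> forall d, d \in end_pairs ->
  0 <= (1 : R) <= \sum_(e in path_segs d) 1.
Proof.
by move=> _ d /imsetP[e _ ->]; rewrite path_segs_end_pair big_set1 ler01 lexx.
Qed.

(** The threshold 1 is the whole improvement along an OD pair, which consists of one segment; this
    makes MinImprov agree with Linear. *)
Definition power_instance : instance R rsp :=
  @Instance R rsp m.+1 (ltn0Sn m) (fun e => 2 ^ e)%N power_cost_gt0
    unit (fun=> [set: 'I_m.+1.-1]%SET) power_muni_disjoint
    power_muni_consecutive power_muni_cover
    (fun=> 1) (fun=> ltr01) power_share_sum
    end_pairs power_od_neq (fun d => 2 ^ d.1)%N power_passengers_gt0
    (fun=> 1) (fun=> ltr01) (fun=> 1) power_threshold_bounds.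

Lemma attracted_power (F : {set 'I_m}) :
  attracted power_instance F = (\sum_(e in F) 2 ^ e)%N%:R.
Proof.
rewrite /attracted /= /end_pairs big_imset /=; last exact: in2W end_pair_inj.
rewrite natr_sum [RHS]big_mkcond; apply: eq_big => [e|e _]; first by rewrite inE.
rewrite /attracted_by /= path_segs_end_pair big_set1.
(* The improvement gained by the pair of [e] is the indicator of [e \in F]. *)
have -> : \sum_(f in (F :&: [set e])%SET) (1 : R) = (e \in F)%:R.
  rewrite sumr_const; congr (_%:R); case: (boolP (e \in F)) => eF.
    by rewrite (finset.setIidPr _) ?cards1 ?finset.sub1set.
  by apply: eq_card0 => f; rewrite !inE; apply/negP => /andP[fF /eqP fe];
    rewrite -fe fF in eF.
case: (e \in F); case: rsp; rewrite ?divr1 ?mulr1 ?mulr0 ?lexx //.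
by rewrite ler10.
Qed.

(** The only municipality has share 1, so its constraint bounds the total cost, which equals [p F],
    by [v]; this also forces [0 <= v]. *)
Lemma feasible_power (F : {set 'I_m}) (v : R) :
  feasible power_instance F v <-> attracted power_instance F <= v.
Proof.
rewrite attracted_power /feasible /=; split=> [[_ /(_ tt)]|le_v].
  by rewrite finset.setIT mul1r.
split=> [|x]; first exact: le_trans le_v.
by rewrite finset.setIT mul1r.
Qed.

Lemma pareto_front_power : pareto_front power_instance =
  [set (attracted power_instance F, attracted power_instance F)
     | F in [set: {set 'I_m}]]%classic.
Proof.
apply/seteqP; split=> [_ [F [v [/feasible_power Fv nd ->]]]|_ [F _ <-]] /=.
  exists F => //; congr pair; apply/eqP; rewrite eq_le Fv leNgt /=.
  (* Otherwise lowering the budget to [p F] while keeping [F] would dominate. *)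
  apply/negP => lt_v; apply: nd; exists F, (attracted power_instance F).
  by split; [exact/feasible_power | | | right].
exists F, (attracted power_instance F).
split=> //; first exact/feasible_power.
move=> [F' [v' [/feasible_power F'v' le_p le_v]]].
(* A dominating pair gives [p F <= p F' <= v' <= p F], which leaves no room for a strict
   inequality. *)
have le_p' := le_trans F'v' le_v.
by case=> [|/(le_lt_trans (le_trans le_p F'v'))]; rewrite ?ltxx // ltNge le_p'.
Qed.

Lemma card_pareto_front_power :
  (2 ^ m <= #|` fset_set (pareto_front power_instance)|)%N.
Proof.
(* Finiteness matters: [fset_set] sends an infinite set to the empty one. *)
have fin : finite_set (pareto_front power_instance).
  by rewrite pareto_front_power; exact: finite_image.
(* Every diagonal point [(k, k)] with [k < 2 ^ m] lies on the front. *)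
pose g (k : 'I_(2 ^ m)) : R * R := (k%:R, k%:R).
have g_inj : injective g.
  by move=> k l [/eqP]; rewrite eqr_nat => /eqP kl _; apply: val_inj.
have -> : (2 ^ m = #|` [fset g k | k in 'I_(2 ^ m)]%fset|)%N.
  by rewrite card_imfset //= -cardE card_ord.
apply/fsubset_leq_card/fsubsetP => _ /imfsetP[k _ ->].
rewrite in_fset_set //; apply/mem_set; rewrite pareto_front_power.
by have [F Fk] := sum_pow2_onto (ltn_ord k); exists F; rewrite // attracted_power Fk.
Qed.

Lemma encoding_size_power :
  (encoding_size power_instance <= 30 * m.+1 ^ 3)%N.
Proof.
rewrite /encoding_size /= real_bits1.
set A := nat_bits _; set B := bigop.body _ _ _; set C := bigop.body _ _ _.
set D := bigop.body _ _ _.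
have hA : (A <= m.+2)%N by exact: nat_bits_le.
have hB : (B <= m * (m + 3))%N.
  rewrite -[X in (_ <= X * _)%N]card_ord -sum_nat_const.
  by apply: leq_sum => e _; rewrite nat_bits_pow2; have := ltn_ord e; lia.
have hC : (C <= 3 + m * m)%N.
  rewrite /C sum_nat_const card_unit mul1n leq_add2l.
  rewrite -[X in (_ <= X * _)%N]card_ord -cardsT -sum_nat_const.
  by apply: leq_sum => e _; have := nat_bits_le e; have := ltn_ord e; lia.
have hD : (D <= m * (3 * m + 6))%N.
  have -> : (m * (3 * m + 6) = \sum_(d in end_pairs) (3 * m + 6))%N.
    by rewrite sum_nat_const card_imset ?cardsT ?card_ord //; exact: end_pair_inj.
  apply: leq_sum => _ /imsetP[e _ ->]; rewrite nat_bits_pow2 /= /bump /=.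
  have := nat_bits_le e; have := nat_bits_le (1 + e); have := ltn_ord e.
  by case: rsp; lia.
(* The four bounds add up to [5 * m.+1 ^ 2], so the cubic bound is generous. *)
by rewrite !expnS expn0; nia.
Qed.

Lemma rational_data_power : rational_data power_instance.
Proof. by split=> *; apply/mem_set; exists 1; rewrite ?rmorph1. Qed.

End PowerInstance.

Theorem theorem9 (R : realType) (rsp : response) :
  @intractable R rsp (fun I => (1 <= #|muni I|)%N) /\
  @intractable R rsp (fun I => #|muni I| = 1%N).
Proof.
have intr (C : instance R rsp -> Prop) :
    (forall m, C (power_instance R rsp m)) -> intractable C.
  move=> CI; exists (fun n => power_instance R rsp n.-1); split; [|split].
  - by case=> // n _; split=> //; exact: rational_data_power.
  - by exists 30%N, 3%N => -[//|n] _; exact: encoding_size_power.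
  (* With [n] vertices the bound on the front is [2 ^ (n - 1)], so the base must be below 2; [3 / 2]
     works from [n = 3] on. *)
  exists (3%:R / 2%:R); first by rewrite ltr_pdivlMr ?ltr0n // mul1r ltr_nat.
  exists 3%N => -[//|n] n_ge.
  apply: (@le_trans _ _ (2 ^ n)%N%:R); last first.
    by rewrite ler_nat card_pareto_front_power.
  rewrite expr_div_n ler_pdivrMr ?exprn_gt0 ?ltr0n // -!natrX -natrM ler_nat.
  (* The induction starts at [27 <= 32]; each further vertex multiplies the left side by 3 and the
     right side by 4. *)
  elim: n n_ge => [//|[//|[//|n]] IH] _ //.
  have := IH isT; rewrite !expnS; lia.
by split; apply: intr => m; rewrite /= card_unit.
Qed.
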